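(* Let $\mu,x,y\in\mathbb{R}$ and $T>0$ be fixed. Let $W$ be a standard one-dimensional Brownian motion started at $0$, set $\hat X(s)=x-\mu s+W(s)$ for $0\le s\le T$, and let $\hat X(T-\cdot)=(\hat X(T-t))_{0\le t\le T}$ be the backward sample path. Then $\tilde\Theta_{y,T}(\hat X(T-\cdot))(T)$ (the value at time $T$ of the path $\tilde\Theta_{y,T}(\hat X(T-\cdot))$) has the same distribution as $W(T)$.
   Context: For a continuous path $X=(X(t))_{0\le t\le T}$ in $\mathbb{R}$, set $\omega(t)=X(t)-X(0)-\mu t$ for $0\le t\le T$. If $y\ge X(0)$, set $$L(t)=-\min_{0\le v\le t}\big([y-X(0)-2\omega(v)]\wedge 0\big),\qquad 0\le t\le T,$$ where $a\wedge b=\min\{a,b\}$. The map $\tilde\Theta_{y,T}$ from paths on $[0,T]$ to paths on $[0,T]$ is defined by $$\tilde\Theta_{y,T}(X)=\begin{cases}(-\omega(t))_{0\le t\le T} & \text{if } X(0)>y,\\ (\omega(t)-L(t))_{0\le t\le T} & \text{if } y\ge X(0).\end{cases}$$ *)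

(* Defs.v *)
From HB Require Import structures.
From mathcomp Require Import all_boot all_order all_algebra.
From mathcomp Require Import all_classical all_reals all_analysis.
Set Implicit Arguments.
Unset Strict Implicit.
Unset Printing Implicit Defensive.
Import Order.TTheory GRing.Theory Num.Theory.
Import numFieldNormedType.Exports.
Local Open Scope classical_set_scope.
Local Open Scope ring_scope.

Section Probability.
Context {d : measure_display} {Omega : measurableType d} {R : realType}.
Variable P : probability Omega R.

(* The [B i] may be taken to be [setT], so the product rule for the whole
   family entails the product rule for each subfamily. *)
Definition independent_family (n : nat) (X : 'I_n -> Omega -> R) : Prop :=
  forall B : 'I_n -> set R, (forall i, measurable (B i)) ->
    P (\bigcap_(i in [set: 'I_n]) (X i @^-1` B i)) =
    (\prod_(i < n) P (X i @^-1` B i))%E.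

(* Equality of laws is only tested on Borel sets: [P], hence [pushforward P f],
   is a total function on sets with no meaning outside the sigma-algebra. *)
Definition same_distribution (f g : Omega -> R) : Prop :=
  [/\ measurable_fun setT f, measurable_fun setT g &
      forall B : set R, measurable B -> pushforward P f B = pushforward P g B].

(* Only the values [W t] with [0 <= t] are constrained.  The second parameter of
   [normal_prob] is the standard deviation.  A nondecreasing finite tuple of
   times is given by the first [n.+1] terms of a nondecreasing sequence. *)
Record standard_brownian_motion (W : R -> Omega -> R) : Prop := {
  bm_measurable : forall t : R, 0 <= t -> measurable_fun setT (W t) ;
  bm_start : {ae P, forall w, W 0 w = 0} ;
  bm_indep_increments : forall (n : nat) (t : nat -> R),
    0 <= t 0%N -> {homo t : i j / (i <= j)%N >-> i <= j} ->
    independent_family (fun (i : 'I_n) w => W (t i.+1) w - W (t i) w) ;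
  bm_gaussian_increments : forall s t : R, 0 <= s -> s < t ->
    forall B : set R, measurable B ->
    pushforward P (fun w => W t w - W s w) B =
    normal_prob 0 (Num.sqrt (t - s)) B ;
  bm_continuous : forall w, {within `[0, +oo[, continuous (fun t => W t w)}
}.

End Probability.

(* A path on [0, T] is encoded as a function on the whole line, whose values
   outside [0, T] are irrelevant. *)
Section Theta.
Context {R : realType}.
Variables (mu y : R).

Definition omega_path (X : R -> R) (t : R) : R := X t - X 0 - mu * t.

(* For a continuous path the infimum below is a minimum. *)
Definition L_path (X : R -> R) (t : R) : R :=
  - inf [set Num.min (y - X 0 - 2 * omega_path X v) 0 | v in `[0, t]].

(* The resulting path on [0, T] is extended by 0. *)
Definition Theta_tilde (T : R) (X : R -> R) : R -> R :=
  patch (fun=> 0) `[0, T]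
    (if y < X 0 then fun t => - omega_path X t
     else fun t => omega_path X t - L_path X t).

End Theta.

(* Main.v *)
Require Import Defs.
From HB Require Import structures.
From mathcomp Require Import all_boot all_order all_algebra.
From mathcomp Require Import all_classical all_reals all_analysis.
From mathcomp Require Import measurable_realfun ring lra.
Import Order.TTheory GRing.Theory Num.Theory.
Import numFieldNormedType.Exports.
Local Open Scope classical_set_scope.
Local Open Scope ring_scope.
Set Implicit Arguments.
Unset Strict Implicit.
Unset Printing Implicit Defensive.

(** Write [a = y - x + mu * T], let [M] be the maximum of [W] on [0, T] and take
    [W 0 = 0].  The drift cancels in [omega_path], and the value at [T] of the
    transformed reversed path is [W T] on [a < W T] and
    [min (a - 2 * M) (- W T)] on [W T <= a] (in the form of [Theta_tilde_ge]).
    The theorem thus only concerns the joint law of [M] and [W T], which the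
    reflection principle gives: for [0 <= b] and [c <= b],
    [P (M > b, W T <= c) = P (W T > 2 * b - c)].  Computing the probability that
    the transformed value is at least [z] then amounts to taking
    [b = (a - z) / 2] and [c = min(a, - z)], and the answer is that of [W T] by
    symmetry ([prob_Theta_tilde_ge]).

    The reflection principle is obtained without the strong Markov property.
    The motion is sampled on a finite grid, where the first passage above [b]
    takes finitely many values; on each of them, the future increment can be
    replaced by its opposite ([reflect_future]), because it is symmetric and
    independent of the past.  A walk overshoots the level [b], so one gets an
    inequality ([prob_crossing_le]) and a converse with an error controlled by
    the size of the steps ([prob_crossing_ge]).  Uniform continuity of paths on
    dyadic grids removes the error ([reflection_principle]). *)

(** * Laws and independence *)

Lemma normal_probN (R : realType) (s : R) (B : set R) : s != 0 ->
  measurable B -> normal_prob 0 s (-%R @^-1` B) = normal_prob 0 s B.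
Proof.
move=> s0 mB; rewrite /normal_prob.
have mpdf : measurable_fun B (EFin \o normal_pdf 0 s).
  by apply/measurable_EFinP/measurable_funTS; exact: measurable_normal_pdf.
transitivity (\int[pushforward lebesgue_measure
    (-%R : _ -> measurableTypeR R)]_(x in B) (normal_pdf 0 s x)%:E)%E.
  rewrite ge0_integral_pushforward//=; last first.
    by move=> x _; rewrite lee_fin normal_pdf_ge0.
  apply: eq_integral => x _ /=.
  by rewrite normal_pdfE// /normal_fun !subr0 sqrrN.
by apply: eq_measure_integral => //= A mA _; exact: lebesgue_measureN.
Qed.

Lemma measurable_le_fun d (Omega : measurableType d) (R : realType)
    (f g : Omega -> R) : measurable_fun setT f ->
  measurable_fun setT g -> measurable [set w | f w <= g w].
Proof.
move=> mf mg; rewrite -[X in measurable X]setTI.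
exact: (measurable_fun_ler mf mg).
Qed.

Lemma measurable_lt_fun d (Omega : measurableType d) (R : realType)
    (f g : Omega -> R) : measurable_fun setT f ->
  measurable_fun setT g -> measurable [set w | f w < g w].
Proof.
move=> mf mg; rewrite -[X in measurable X]setTI.
exact: (measurable_fun_ltr mf mg).
Qed.

Lemma same_distribution_ge d (Omega : measurableType d) (R : realType)
    (P : probability Omega R) (X Y : Omega -> R) :
  measurable_fun setT X -> measurable_fun setT Y ->
  (forall z, P [set w | z <= X w] = P [set w | z <= Y w]) ->
  same_distribution P X Y.
Proof.
move=> mX mY XY; split => // B mB.
pose X' : {mfun Omega >-> R} := mfun_Sub (mem_set mX).
pose Y' : {mfun Omega >-> R} := mfun_Sub (mem_set mY).
apply: (measure_unique (@RGenCInfty.G R) (fun k => `[- k%:R, +oo[%classic)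
  _ _ _ _ (pushforward P X') (pushforward P Y')) => //.
- exact: RGenCInfty.measurableE.
- move=> _ _ [x ->] [z ->]; exists (Num.max x z).
  by apply/seteqP; split=> t /=; rewrite !in_itv/= !andbT ge_max => /andP.
- by move=> k; exists (- k%:R).
- apply/seteqP; split => // t _; exists (Num.truncn `|t|).+1 => //=.
  rewrite in_itv/= andbT lerNl (le_trans _ (ltW (truncnS_gt _)))//.
  by rewrite -normrN ler_norm.
- move=> _ [z ->]; have E (V : Omega -> R) :
      V @^-1` `[z, +oo[ = [set w | z <= V w].
    by apply/seteqP; split=> w /=; rewrite in_itv/= andbT.
  change (P (X @^-1` `[z, +oo[) = P (Y @^-1` `[z, +oo[)).
  by rewrite !E.
- move=> k; rewrite /= /pushforward ltey_eq fin_num_measure//.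
  by rewrite -[X in measurable X]setTI; exact: (mX).
Qed.

(** Both sides are finite measures in [A], so Dynkin's theorem extends the
    product rule from a generating class closed under intersection.  Events
    about a running maximum are not boxes of increments; this lemma is what
    makes them independent of the future. *)
Lemma independent_g_sigma d (Omega : measurableType d) (R : realType)
    (P : probability Omega R) (G : set (set Omega)) (C : set Omega) :
  G `<=` measurable -> setI_closed G -> G setT -> measurable C ->
  (forall A, G A -> P (A `&` C) = (P A * P C)%E) ->
  forall A, <<s G >> A -> P (A `&` C) = (P A * P C)%E.
Proof.
move=> Gm GI GT mC PG A sGA.
have p0 : 0 <= fine (P C) by rewrite fine_ge0.
have E B : mscale (NngNum p0) P B = (P B * P C)%E.
  by rewrite /mscale/= fineK ?fin_num_measure// muleC.
transitivity (mscale (NngNum p0) P A); last exact: E.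
apply: (g_sigma_algebra_measure_unique G _ (fun=> setT) _ _
  (mrestr P mC) (mscale (NngNum p0) P)) => //.
- by rewrite bigcup_const//; exists 0%N.
- by move=> B GB; transitivity (P B * P C)%E; [exact: PG|exact/esym/E].
- by move=> _; rewrite /= /mrestr setTI ltey_eq fin_num_measure.
Qed.

(** On the event [A], the laws of [(X, Y)] and [(X, Z)] are finite measures on
    the plane, and rectangles form a generating class closed under
    intersection. *)
Lemma eq_prob_pair d (Omega : measurableType d) (R : realType)
    (P : probability Omega R) (A : set Omega) (X Y Z : Omega -> R) :
  measurable A -> measurable_fun setT X -> measurable_fun setT Y ->
  measurable_fun setT Z ->
  (forall B C, measurable B -> measurable C ->
    P ((X @^-1` B `&` Y @^-1` C) `&` A) = P ((X @^-1` B `&` Z @^-1` C) `&` A)) ->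
  forall E : set (R * R), measurable E ->
    P ([set w | E (X w, Y w)] `&` A) = P ([set w | E (X w, Z w)] `&` A).
Proof.
move=> mA mX mY mZ XYZ E mE.
have mXY := measurable_fun_pair mX mY.
have mXZ := measurable_fun_pair mX mZ.
pose U : {mfun Omega >-> (R * R)%type} := mfun_Sub (mem_set mXY).
pose V : {mfun Omega >-> (R * R)%type} := mfun_Sub (mem_set mXZ).
apply: (measure_unique [set B `*` C | B in measurable & C in measurable]
  (fun=> setT) _ _ _ _
  (pushforward (mrestr P mA) U) (pushforward (mrestr P mA) V)) => //.
- exact: measurable_prod_measurableType.
- move=> _ _ [B mB [C mC <-]] [B' mB' [C' mC' <-]].
  exists (B `&` B'); first exact: measurableI.
  by exists (C `&` C'); [exact: measurableI|rewrite setXI].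
- by move=> _; exists setT => //; exists setT => //; rewrite setXTT.
- by rewrite bigcup_const//; exists 0%N.
- by move=> _ [B mB [C mC <-]]; exact: XYZ.
- by move=> _; rewrite /= /pushforward /mrestr setTI ltey_eq fin_num_measure.
Qed.

(** * The reflection principle for symmetric walks *)

Section SymmetricWalk.
Context {d : measure_display} {Omega : measurableType d} {R : realType}.
Variable P : probability Omega R.

Definition increment (S : nat -> Omega -> R) (i j : nat) (w : Omega) : R :=
  S j w - S i w.

(** The boxes of the first [k] increments generate the past at time [k]; unlike
    the whole past they are directly in the scope of a product rule. *)
Definition past_boxes (S : nat -> Omega -> R) (k : nat) : set (set Omega) :=
  [set A | exists2 B : nat -> set R, (forall i, measurable (B i)) &
    A = \bigcap_(i in `I_k) (increment S i i.+1 @^-1` B i)].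

Record symmetric_walk (n : nat) (S : nat -> Omega -> R) : Prop := {
  walk_measurable : forall k, measurable_fun setT (S k) ;
  walk_start : forall w, S 0%N w = 0 ;
  walk_indep : forall k A C, (k <= n)%N -> past_boxes S k A -> measurable C ->
    P (A `&` increment S k n @^-1` C) =
    (P A * P (increment S k n @^-1` C))%E ;
  walk_sym : forall k C, (k <= n)%N -> measurable C ->
    P (increment S k n @^-1` C) =
    P ((\- increment S k n) @^-1` C)
}.

Definition first_passage (S : nat -> Omega -> R) (b : R) (k : nat) :
    set Omega :=
  [set w | b < S k w /\ forall j, (j < k)%N -> S j w <= b].

Definition crossing (S : nat -> Omega -> R) (b : R) (n : nat) : set Omega :=
  [set w | exists2 k, (k <= n)%N & b < S k w].

Variables (n : nat) (S : nat -> Omega -> R).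
Hypothesis walkS : symmetric_walk n S.

Let mS k : measurable_fun setT (S k). Proof. exact: (walk_measurable walkS). Qed.

Lemma past_boxes_measurable k : past_boxes S k `<=` measurable.
Proof.
move=> _ [B mB ->]; apply: fin_bigcap_measurable => // i _.
rewrite -[X in measurable X]setTI.
by apply: measurable_funB => //.
Qed.

Lemma past_boxes_setI k : setI_closed (past_boxes S k).
Proof.
move=> _ _ [B mB ->] [C mC ->]; exists (fun i => B i `&` C i).
  by move=> i; exact: measurableI.
by rewrite -bigcapI; apply: eq_bigcapr => i _; rewrite preimage_setI.
Qed.

Lemma past_boxes_setT k : past_boxes S k setT.
Proof.
by exists (fun=> setT) => //; apply/esym/seteqP; split.
Qed.

Lemma sub_past_measurable k : <<s past_boxes S k >> `<=` measurable.
Proof.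
apply: smallest_sub; first exact: sigma_algebra_measurable.
exact: past_boxes_measurable.
Qed.

(** Partial sums are determined by the increments because the walk starts at
    0. *)
Lemma past_measurable j k : (j <= k)%N ->
  measurable_fun (setT : set (g_sigma_algebraType (past_boxes S k))) (S j).
Proof.
elim: j => [_|j IHj jk].
  rewrite (_ : S 0%N = cst 0) //; apply/funext => w.
  exact: walk_start walkS w.
rewrite (_ : S j.+1 = S j \+ (fun w => S j.+1 w - S j w)); last first.
  by apply/funext => w /=; rewrite addrC subrK.
apply: measurable_funD; first by apply: IHj; exact: ltnW.
move=> _ B mB; rewrite setTI; apply: sub_sigma_algebra.
exists (fun i => if i == j then B else setT); first by move=> i; case: ifP.
apply/seteqP; split=> w /=.
  by move=> Bw i _ /=; case: eqP => // ->.
by move=> /(_ j jk) /=; rewrite eqxx.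
Qed.

Lemma first_passage_past b k :
  <<s past_boxes S k >> (first_passage S b k).
Proof.
rewrite (_ : first_passage S b k = S k @^-1` `]b, +oo[ `&`
    \bigcap_(j in `I_k) (S j @^-1` `]-oo, b])); last first.
  apply/seteqP; split => w /=; rewrite in_itv/= andbT => -[bS h]; split => //.
have mpre j (B : set R) : (j <= k)%N -> measurable B ->
    <<s past_boxes S k >> (S j @^-1` B).
  by move=> jk mB; rewrite -[S j @^-1` B]setTI; exact: past_measurable.
apply: (@measurableI _ (g_sigma_algebraType (past_boxes S k))).
  exact: mpre.
apply: (@fin_bigcap_measurable _ (g_sigma_algebraType (past_boxes S k))) => //.
by move=> j /= jk; apply: mpre => //; exact: ltnW.
Qed.

(** Reflecting the walk after time [k] replaces [S n - S k] by its opposite,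
    which has the same law and is independent of the past, of [A] and [S k] in
    particular. *)
Lemma reflect_future k A c : (k <= n)%N -> <<s past_boxes S k >> A ->
  P (A `&` [set w | S n w <= c]) =
  P (A `&` [set w | 2 * S k w - S n w <= c]).
Proof.
move=> kn sA; pose D := increment S k n.
have mD : measurable_fun setT D by exact: measurable_funB.
have mND : measurable_fun setT (\- D).
  exact: measurable_funN.
pose E : set (R * R) := [set p | p.1 + p.2 <= c].
have mE : measurable E.
  rewrite (_ : E = setT `&` (fun p : R * R => p.1 + p.2) @^-1` `]-oo, c]).
    by apply: (measurable_funD measurable_fst measurable_snd).
  by rewrite setTI; apply/seteqP; split => p /=; rewrite in_itv.
have mA := sub_past_measurable sA.
have := @eq_prob_pair _ _ _ P A (S k) D (\- D) mA (mS k) mD mND _ E mE.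
rewrite !(setIC A) => h.
rewrite (_ : [set w | S n w <= c] = [set w | E (S k w, D w)]).
  rewrite h => [|B C mB mC].
    by congr (P (_ `&` _)); apply/seteqP; split => w; rewrite /E/D/increment/=; lra.
  have sAB : <<s past_boxes S k >> (S k @^-1` B `&` A).
    apply: (@measurableI _ (g_sigma_algebraType (past_boxes S k))) => //.
    by rewrite -[S k @^-1` B]setTI; exact: past_measurable.
  have mDC : measurable (D @^-1` C).
    by rewrite -[X in measurable X]setTI; exact: mD.
  have mNDC : measurable ((\- D) @^-1` C).
    by rewrite -[X in measurable X]setTI; exact: mND.
  rewrite (setIAC _ (D @^-1` C)) (setIAC _ ((\- D) @^-1` C)).
  have G F : measurable F ->
    (forall A', past_boxes S k A' -> P (A' `&` F) = (P A' * P F)%E) ->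
    P (S k @^-1` B `&` A `&` F) = (P (S k @^-1` B `&` A) * P F)%E.
    move=> mF hF; apply: (independent_g_sigma _ _ _ _ _ sAB) => //.
    - exact: past_boxes_measurable.
    - exact: past_boxes_setI.
    - exact: past_boxes_setT.
  rewrite G//; last by move=> A' hA'; exact: walk_indep.
  rewrite G//.
    by congr (_ * _)%E; exact: walk_sym.
  move=> A' hA'.
  have mNC : measurable (-%R @^-1` C).
    by rewrite -[X in measurable X]setTI; exact: oppr_measurable.
  exact: (walk_indep walkS kn hA' mNC).
by apply/seteqP; split => w; rewrite /E/D/increment/=; lra.
Qed.

Lemma first_passage_measurable b k : measurable (first_passage S b k).
Proof. by apply: sub_past_measurable; exact: first_passage_past. Qed.

Lemma crossing_first_passage b w : crossing S b n w ->
  exists2 k, (k <= n)%N & first_passage S b k w.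
Proof.
move=> [k0 k0n bS].
have ex : exists k, b < S k w by exists k0.
case: (ex_minnP ex) => k bk mink; exists k.
  by rewrite (leq_trans (mink _ bS)).
split => // j jk; rewrite leNgt; apply/negP => /mink.
by rewrite leqNgt jk.
Qed.

Lemma prob_first_passage b (C : nat -> set Omega) :
  (forall k, measurable (C k)) ->
  P [set w | exists2 k, (k <= n)%N & (first_passage S b k `&` C k) w] =
  (\sum_(k < n.+1) P (first_passage S b k `&` C k))%E.
Proof.
move=> mC; pose F k := first_passage S b k `&` C k.
rewrite -(@measure_semi_additive_ord_I _ _ _ P F) //.
- congr (P _); rewrite -(bigcup_mkord n.+1 F); apply/seteqP; split => w.
    by move=> [k kn h]; exists k.
  by move=> [k kn h]; exists k.
- by move=> k _; apply: measurableI => //; exact: first_passage_measurable.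
- apply/trivIsetP => i j _ _ ij; apply/seteqP; split => // w [].
  move=> [[bi ib] _] [[bj jb] _].
  by case: (ltngtP i j) ij => // [/jb|/ib]; rewrite leNgt ?bi ?bj.
- by apply: bigsetU_measurable => i _; apply: measurableI => //;
    exact: first_passage_measurable.
Qed.

(** The walk reflected at its first passage above [b] has the same law as the
    walk itself: [reflect_future] applies on each event where the first passage
    takes place at a given time. *)
Lemma prob_crossing_reflected b c :
  P (crossing S b n `&` [set w | S n w <= c]) =
  P [set w | exists2 k, (k <= n)%N &
    (first_passage S b k `&` [set w | 2 * S k w - S n w <= c]) w].
Proof.
have mle k : measurable [set w | 2 * S k w - S n w <= c].
  apply: measurable_le_fun => //; apply: measurable_funB => //.
  exact: measurable_funM.
rewrite prob_first_passage//.
under eq_bigr => k _.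
  rewrite -reflect_future; [over|by rewrite -ltnS|exact: first_passage_past].
rewrite -(@prob_first_passage b (fun=> [set w | S n w <= c])).
  congr (P _); apply/seteqP; split => w.
    by move=> [/crossing_first_passage[k kn fk] h]; exists k.
  by move=> [k kn [[bk _] h]]; split => //; exists k.
by move=> _; exact: measurable_le_fun.
Qed.

Lemma measurable_crossing b : measurable (crossing S b n).
Proof.
rewrite (_ : crossing S b n = \bigcup_(k in `I_n.+1) [set w | b < S k w]).
  by apply: bigcup_measurable => k _; exact: measurable_lt_fun.
by apply/seteqP; split => w [k kn h]; exists k.
Qed.

Let measurable_reflected b c : measurable [set w | exists2 k, (k <= n)%N &
  (first_passage S b k `&` [set w | 2 * S k w - S n w <= c]) w].
Proof.
rewrite (_ : mkset _ = \bigcup_(k in `I_n.+1)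
    (first_passage S b k `&` [set w | 2 * S k w - S n w <= c])).
  apply: bigcup_measurable => k _; apply: measurableI.
    exact: first_passage_measurable.
  apply: measurable_le_fun => //; apply: measurable_funB => //.
  exact: measurable_funM.
by apply/seteqP; split => w [k kn h]; exists k.
Qed.

(** At a first passage [S k] is above [b], so that a reflected end point
    [2 * S k - S n] below [c] forces [S n] above [2 * b - c]. *)
Lemma prob_crossing_le b c :
  (P (crossing S b n `&` [set w | S n w <= c]%R) <=
   P [set w | 2 * b - c < S n w]%R)%E.
Proof.
rewrite prob_crossing_reflected; apply: le_measure; rewrite ?inE//.
  exact: measurable_lt_fun.
by move=> w [k kn [[bk _]]] /=; lra.
Qed.

Definition steps_le (e : R) : set Omega :=
  [set w | forall i, (i < n)%N -> S i.+1 w <= S i w + e].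

Lemma measurable_steps_le e : measurable (steps_le e).
Proof.
rewrite (_ : steps_le e =
    \bigcap_(i in `I_n) [set w | S i.+1 w <= S i w + e]) //.
apply: fin_bigcap_measurable => // i _.
by apply: measurable_le_fun => //; exact: measurable_funD.
Qed.

(** The converse of [prob_crossing_le] up to the overshoot: when the steps are
    at most [e], a first passage lands below [b + e].  The bounds on [c] and [e]
    put the end point above [b], so that a passage does occur. *)
Lemma prob_crossing_ge b c e : 0 <= b -> c <= b -> 0 < e ->
  (P (steps_le e `&` [set w | 2 * b + 2 * e - c <= S n w]%R) <=
   P (crossing S b n `&` [set w | S n w <= c]%R))%E.
Proof.
move=> b0 cb e0; rewrite prob_crossing_reflected.
apply: le_measure; rewrite ?inE//.
  apply: measurableI; first exact: measurable_steps_le.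
  exact: measurable_le_fun.
move=> w [/= osc Sn].
have /crossing_first_passage[k kn fk] : crossing S b n w.
  by exists n => //; lra.
exists k => //; split => //=.
(* The first passage is not at time 0 because the walk starts at [0 <= b]. *)
case: fk => bk; case: k kn bk => [|k] kn bk fk.
  by move: bk; rewrite (walk_start walkS); lra.
by have := fk k (ltnSn k); have := osc k kn; lra.
Qed.

End SymmetricWalk.

(** * The reflection principle for Brownian motion *)

Lemma segment_uniformly_continuous (R : realType) (f : R -> R) (T e : R) :
  {within `[0, T], continuous f} -> 0 < e ->
  exists2 h, 0 < h & forall s t, 0 <= s <= T -> 0 <= t <= T ->
    `|s - t| < h -> `|f s - f t| <= e.
Proof.
move=> cf e0.
have := @segment_compact R 0 T => /compact_near_coveringP.
pose Q (h s : R) := 0 <= s <= T -> forall t, 0 <= t <= T ->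
  `|s - t| < h -> `|f s - f t| <= e.
move=> /(_ R (0^'+) Q _) [].
- move=> x; rewrite /= in_itv/= => xT.
  move/subspace_continuousP : cf => /(_ x); rewrite /= in_itv/= => /(_ xT).
  move=> /cvgrPdist_lt /(_ (e / 2)) /(_ (divr_gt0 e0 (ltr0n _ 2))).
  rewrite /prop_near1 /nbhs/= => -[r /= r0 xr].
  have r20 : 0 < r / 2 by rewrite divr_gt0.
  exists (ball x (r / 2), [set h | h < r / 2]) => /=.
    split; first exact: nbhsx_ballx.
    exact: nbhs_right_lt.
  move=> [s h]/= [xs hr] sT t tT st.
  have /(_ s) h1 := xr; have /(_ t) h2 := xr.
  have {}h1 : `|f x - f s| < e / 2.
    apply: h1; last by rewrite /= in_itv.
    rewrite /ball/= in xs; rewrite /=; lra.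
  have {}h2 : `|f x - f t| < e / 2.
    apply: h2; last by rewrite /= in_itv.
    rewrite /ball/= in xs; rewrite /=.
    have := ler_distD s x t; lra.
  have := ler_distD (f x) (f s) (f t); rewrite (distrC (f s) (f x)); lra.
- move=> h /= [h0 hQ].
  have h20 : 0 < h / 2 by rewrite divr_gt0.
  exists (h / 2) => // s t sT tT st.
  apply: (hQ (h / 2)) => //=; rewrite ?in_itv//.
  by rewrite sub0r normrN gtr0_norm// ltr_pdivrMr// ltr_pMr// ltr1n.
Qed.

Lemma prob_bigcup_le d (Omega : measurableType d) (R : realType)
    (P : probability Omega R) (A : nat -> set Omega) (q : \bar R) :
  (forall n, measurable (A n)) -> nondecreasing_seq A ->
  (forall n, P (A n) <= q)%E -> (P (\bigcup_n A n) <= q)%E.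
Proof.
move=> mA ndA Aq.
have cA := nondecreasing_cvg_mu (mu := P) mA (bigcupT_measurable _ mA) ndA.
rewrite -(cvg_lim (@ereal_hausdorff R) cA).
apply: lime_le; first by apply/cvg_ex; eexists; exact: cA.
exact: nearW.
Qed.

Section BrownianReflection.
Context {d : measure_display} {Omega : measurableType d} {R : realType}.
Variables (P : probability Omega R) (W : R -> Omega -> R).
Hypothesis bmW : standard_brownian_motion P W.

Definition sampled_walk (t : nat -> R) (k : nat) (w : Omega) : R :=
  W (t k) w - W 0 w.

Lemma increment_sym (s t : R) (C : set R) : 0 <= s <= t -> measurable C ->
  P ((fun w => W t w - W s w) @^-1` C) =
  P ((fun w => - (W t w - W s w)) @^-1` C).
Proof.
move=> /andP[s0]; rewrite le_eqVlt => /predU1P[<- mC|st mC].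
  by congr (P _); apply/seteqP; split => w /=; rewrite subrr oppr0.
have gauss := bm_gaussian_increments bmW s0 st.
rewrite /pushforward in gauss; rewrite gauss//.
have mNC : measurable (-%R @^-1` C).
  by rewrite -[X in measurable X]setTI; exact: oppr_measurable.
rewrite -normal_probN ?sqrtr_eq0 -?ltNge ?subr_gt0//.
by rewrite -gauss.
Qed.

Lemma sampled_walk_symmetric (t : nat -> R) (n : nat) : t 0%N = 0 ->
  {homo t : i j / (i <= j)%N >-> i <= j} ->
  symmetric_walk P n (sampled_walk t).
Proof.
move=> t0 ndt.
have t_ge0 k : 0 <= t k by rewrite -t0 ndt.
have mW k : measurable_fun setT (W (t k)) by exact: (bm_measurable bmW).
have incrE i j :
    increment (sampled_walk t) i j = fun w => W (t j) w - W (t i) w.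
  by apply/funext => w; rewrite /increment /sampled_walk; lra.
split.
- move=> k; apply: measurable_funB => //; exact: (bm_measurable bmW).
- by move=> w; rewrite /sampled_walk t0 subrr.
- move=> k A C kn [B mB ->] mC.
  (* The increments along [u] are the first [k] steps, then the whole future. *)
  pose u i := if (i <= k)%N then t i else t n.
  have u0 : 0 <= u 0%N by rewrite /u t_ge0.
  have ndu : {homo u : i j / (i <= j)%N >-> i <= j}.
    move=> i j ij; rewrite /u; case: (leqP j k) => jk.
      by rewrite (leq_trans ij jk) ndt.
    by case: ifP => // ik; apply: ndt; exact: leq_trans kn.
  have H (E : set R) : measurable E ->
      P (\bigcap_(i in `I_k) (increment (sampled_walk t) i i.+1 @^-1` B i) `&`
         increment (sampled_walk t) k n @^-1` E) =
      ((\prod_(i < k) P (increment (sampled_walk t) i i.+1 @^-1` B i)) *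
       P (increment (sampled_walk t) k n @^-1` E))%E.
    move=> mE.
    have mBE (i : 'I_k.+1) : measurable (if (i < k)%N then B i else E).
      by case: ifP.
    have HH := bm_indep_increments bmW u0 ndu mBE.
    have uk : u k.+1 = t n by rewrite /u ltnn.
    have uS i : (i < k)%N -> u i.+1 = t i.+1 by move=> ik; rewrite /u ik.
    have uE i : (i <= k)%N -> u i = t i by rewrite /u => ->.
    rewrite big_ord_recr/= ltnn uk uE// -!incrE in HH.
    transitivity (P (\bigcap_(i in [set: 'I_k.+1])
        (fun w => W (u i.+1) w - W (u i) w) @^-1`
          (if (i < k)%N then B i else E))).
      congr (P _); apply/seteqP; split => w /=.
        move=> [hB hE] [i ik1] _ /=; case: ltnP => ik.
          rewrite (uS i ik) (uE i (ltnW ik)); have := hB i ik.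
          by rewrite /= incrE.
        have -> : i = k by apply/eqP; rewrite eqn_leq ik -ltnS ik1.
        by rewrite uk (uE k (leqnn k)); rewrite incrE in hE.
      move=> h; split=> [i /= ik|].
        have := h (Ordinal (ltnW ik : (i < k.+1)%N)) Logic.I.
        by rewrite /= ik (uS i ik) (uE i (ltnW ik)) incrE.
      by have := h ord_max Logic.I; rewrite /= ltnn uk (uE k (leqnn k)) incrE.
    rewrite HH; congr (_ * _)%E; apply: eq_bigr => i _ /=.
    by rewrite ltn_ord uS// uE ?incrE// ltnW.
  rewrite H//; congr (_ * _)%E.
  have := H setT measurableT.
  by rewrite preimage_setT setIT probability_setT mule1.
- by move=> k C kn mC; rewrite incrE; apply: increment_sym => //; rewrite t_ge0 ndt.
Qed.

Variable T : R.
Hypothesis T0 : 0 < T.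

(** Successive dyadic grids of [0, T] are nested ([dyadicS]), so that crossing
    events increase with the level [m]. *)
Definition dyadic (m k : nat) : R := T * k%:R / (2 ^ m)%:R.

Let pow2_gt0 m : 0 < (2 ^ m)%:R :> R. Proof. by rewrite ltr0n expn_gt0. Qed.

Lemma dyadic_homo m : {homo dyadic m : i j / (i <= j)%N >-> i <= j}.
Proof.
move=> i j ij; rewrite /dyadic ler_pM2r ?invr_gt0// ler_pM2l//.
by rewrite ler_nat.
Qed.

Lemma dyadic0 m : dyadic m 0 = 0. Proof. by rewrite /dyadic mulr0 mul0r. Qed.

Lemma dyadic_end m : dyadic m (2 ^ m) = T.
Proof. by rewrite /dyadic mulfK// gt_eqF. Qed.

Lemma dyadicS m k : dyadic m.+1 (2 * k) = dyadic m k.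
Proof.
rewrite /dyadic expnS !natrM; field.
by rewrite gt_eqF.
Qed.

Lemma dyadic_itv m k : (k <= 2 ^ m)%N -> 0 <= dyadic m k <= T.
Proof.
move=> km; rewrite -{1}(dyadic0 m) dyadic_homo//=.
by rewrite -[leRHS](dyadic_end m) dyadic_homo.
Qed.

Lemma dyadic_step m k : dyadic m k.+1 - dyadic m k = T / (2 ^ m)%:R.
Proof. by rewrite /dyadic -natr1; lra. Qed.

Lemma dyadic_approx m s : 0 <= s <= T ->
  exists2 k, (k <= 2 ^ m)%N & `|dyadic m k - s| <= T / (2 ^ m)%:R.
Proof.
move=> /andP[s0 sT]; pose z := s * (2 ^ m)%:R / T.
have z0 : 0 <= z by rewrite divr_ge0 ?mulr_ge0// ltW.
have /andP[kz zk] := truncn_itv z0.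
exists (Num.truncn z).
  rewrite -(ler_nat R) (le_trans kz)// ler_pdivrMr// mulrC ler_pM2l//.
have sE : s = T * z / (2 ^ m)%:R.
  by rewrite /z; field; rewrite !gt_eqF.
rewrite {1}sE distrC /dyadic -mulrBl -mulrBr normrM ger0_norm; last first.
  by rewrite mulr_ge0// ?subr_ge0// ltW.
rewrite ger0_norm; last by rewrite invr_ge0 ltW.
rewrite ler_pM2r ?invr_gt0// -[leRHS]mulr1 ler_pM2l//.
by rewrite -natr1 in zk; lra.
Qed.

Lemma dyadic_mesh h : 0 < h -> exists m0, forall m, (m0 <= m)%N ->
  T / (2 ^ m)%:R < h.
Proof.
move=> h0; exists (Num.truncn (T / h)).+1 => m m0m.
rewrite ltr_pdivrMr// -ltr_pdivrMl// mulrC.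
rewrite (lt_le_trans (truncnS_gt _))// ler_nat.
by rewrite (leq_trans m0m)// ltnW// ltn_expl.
Qed.

Definition exceeds (b : R) : set Omega :=
  [set w | exists2 s, 0 <= s <= T & b < W s w - W 0 w].

Let S m := sampled_walk (dyadic m).

Let walkS m : symmetric_walk P (2 ^ m) (S m).
Proof. apply: sampled_walk_symmetric; [exact: dyadic0|exact: dyadic_homo]. Qed.

Let S_end m w : S m (2 ^ m) w = W T w - W 0 w.
Proof. by rewrite /S /sampled_walk dyadic_end. Qed.

Lemma path_uniformly_continuous w e : 0 < e ->
  exists2 h, 0 < h & forall s t, 0 <= s <= T -> 0 <= t <= T ->
    `|s - t| < h -> `|W s w - W t w| <= e.
Proof.
move=> e0; apply: (@segment_uniformly_continuous _ (fun t => W t w)) => //.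
apply: (continuous_subspaceW _ (@bm_continuous _ _ _ _ _ bmW w)).
by move=> s /=; rewrite !in_itv/= andbT => /andP[].
Qed.

(** A continuous path that goes above [b] does so at a dyadic time. *)
Lemma exceedsE b : exceeds b = \bigcup_m crossing (S m) b (2 ^ m).
Proof.
apply/seteqP; split => w; last first.
  by move=> [m _ [k km bS]]; exists (dyadic m k) => //; exact: dyadic_itv.
move=> [s sT bs]; pose e := (W s w - W 0 w - b) / 2.
have e0 : 0 < e by rewrite divr_gt0// subr_gt0.
have [h h0 uc] := path_uniformly_continuous w e0.
have [m0 mesh] := dyadic_mesh h0; exists m0 => //.
have [k km ks] := dyadic_approx m0 sT; exists k => //.
have := uc _ _ (dyadic_itv km) sT (le_lt_trans ks (mesh _ (leqnn _))).
rewrite ler_distl => /andP[+ _]; rewrite /S /sampled_walk /e in e0 *; lra.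
Qed.

(** The level is allowed to be random, since in [Theta_tilde_ge] it involves
    [W 0], which is only almost surely 0. *)
Lemma measurable_exceeds (b : Omega -> R) : measurable_fun setT b ->
  measurable [set w | exceeds (b w) w].
Proof.
move=> mb; rewrite (_ : mkset _ = \bigcup_m \bigcup_(k in `I_(2 ^ m).+1)
    [set w | b w < S m k w]).
  apply: bigcupT_measurable => m; apply: bigcup_measurable => k _.
  by apply: measurable_lt_fun => //; exact: (walk_measurable (walkS m)).
apply/seteqP; split => w /=; rewrite exceedsE.
  by move=> [m _ [k km h]]; exists m => //; exists k.
by move=> [m _ [k km h]]; exists m => //; exists k.
Qed.

Lemma nondecreasing_crossing b :
  nondecreasing_seq (fun m => crossing (S m) b (2 ^ m)).
Proof.
apply/nondecreasing_seqP => m; apply/subsetPset => w [k km bS].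
exists (2 * k)%N; first by rewrite expnS leq_pmul2l.
by rewrite /S /sampled_walk dyadicS.
Qed.

Let mWT : measurable_fun setT (fun w => W T w - W 0 w).
Proof.
by apply: measurable_funB; apply: (bm_measurable bmW) => //; exact: ltW.
Qed.

(** The upper bound is the limit of [prob_crossing_le] along the dyadic grids.
    For the lower bound, [F m] says that all grids finer than level [m] have
    steps at most [eps j]; by uniform continuity of paths the events [F m]
    increase to the sure event, and [prob_crossing_ge] applies on each.  Then
    the allowed overshoot [eps j] tends to 0. *)
Lemma reflection_principle b c : 0 <= b -> c <= b ->
  P (exceeds b `&` [set w | W T w - W 0 w <= c]) =
  P [set w | 2 * b - c < W T w - W 0 w].
Proof.
move=> b0 cb.
have mle (x : R) : measurable [set w | W T w - W 0 w <= x].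
  exact: measurable_le_fun.
have endE x m : [set w | W T w - W 0 w <= x] = [set w | S m (2 ^ m) w <= x].
  by apply/seteqP; split => w /=; rewrite S_end.
apply/eqP; rewrite eq_le; apply/andP; split.
  rewrite exceedsE setI_bigcupl; apply: prob_bigcup_le.
  - move=> m; apply: measurableI => //.
    exact: (measurable_crossing (walkS m)).
  - move=> m1 m2 m12; apply/subsetPset; apply: setSI.
    exact/subsetPset/nondecreasing_crossing.
  - move=> m; rewrite (endE c m) (le_trans (prob_crossing_le (walkS m) _ _))//.
    rewrite (_ : [set w | _ < S m _ w] = [set w | 2 * b - c < W T w - W 0 w])//.
    by apply/seteqP; split => w /=; rewrite S_end.
pose eps j : R := j.+1%:R^-1.
have eps0 j : 0 < eps j by rewrite invr_gt0.
rewrite (_ : [set w | _] =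
    \bigcup_j [set w | 2 * b + 2 * eps j - c <= W T w - W 0 w]); last first.
  apply/seteqP; split => w /= => [lt|[j _] /=]; last first.
    by move: (eps0 j); lra.
  pose r := (W T w - W 0 w - (2 * b - c)) / 2.
  have r0 : 0 < r by rewrite divr_gt0// subr_gt0.
  exists (Num.truncn r^-1) => //=.
  have : eps (Num.truncn r^-1) < r.
    by rewrite /eps -[ltRHS]invrK ltf_pV2 ?posrE ?invr_gt0// truncnS_gt.
  by rewrite /r; lra.
apply: prob_bigcup_le.
- move=> j; exact: measurable_le_fun.
- move=> i j ij; apply/subsetPset => w /=; apply: le_trans.
  rewrite lerB// lerD2l ler_pM2l// lef_pV2 ?posrE//.
  by rewrite ler_nat ltnS.
move=> j.
pose F m := \bigcap_(m' in [set m' | (m <= m')%N])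
  steps_le (2 ^ m') (S m') (eps j).
rewrite (_ : [set w | _] =
    \bigcup_m (F m `&` [set w | 2 * b + 2 * eps j - c <= W T w - W 0 w])); last first.
  apply/seteqP; split => w /= => [lt|[m _ []//]].
  have [h h0 uc] := path_uniformly_continuous w (eps0 j).
  have [m0 mesh] := dyadic_mesh h0; exists m0 => //; split => // m /= m0m i im.
  have itv k : (k <= 2 ^ m)%N -> 0 <= dyadic m k <= T by exact: dyadic_itv.
  have := uc _ _ (itv _ im) (itv _ (ltnW im)).
  rewrite dyadic_step ger0_norm; last by rewrite divr_ge0 ?ltW.
  move=> /(_ (mesh _ m0m)).
  by rewrite ler_distl => /andP[_]; rewrite /S /sampled_walk; lra.
apply: prob_bigcup_le.
- move=> m; apply: measurableI; last exact: measurable_le_fun.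
  apply: bigcap_measurable; first by exists m => /=.
  by move=> m' _; exact: (measurable_steps_le (walkS m')).
- move=> m1 m2 m12; apply/subsetPset; apply: setSI => w h m' /= mm'.
  by apply: h => /=; exact: leq_trans mm'.
move=> m.
apply: (@le_trans _ _ (P (steps_le (2 ^ m) (S m) (eps j) `&`
    [set w | 2 * b + 2 * eps j - c <= S m (2 ^ m) w]%R))).
  apply: le_measure; rewrite ?inE.
  - apply: measurableI; last exact: measurable_le_fun.
    apply: bigcap_measurable; first by exists m => /=.
    by move=> m' _; exact: (measurable_steps_le (walkS m')).
  - apply: measurableI; first exact: (measurable_steps_le (walkS m)).
    by apply: measurable_le_fun => //; exact: (walk_measurable (walkS m)).
  - by move=> w [/(_ m (leqnn m)) ? ?]; split => //=; rewrite S_end.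
apply: (le_trans (prob_crossing_ge (walkS m) b0 cb (eps0 j))).
rewrite -endE; apply: le_measure; rewrite ?inE.
- by apply: measurableI => //; exact: (measurable_crossing (walkS m)).
- by apply: measurableI => //; exact: (measurable_exceeds (b := cst b)).
- by apply: setSI; rewrite exceedsE => w h; exists m.
Qed.

End BrownianReflection.

(** * The law of the transformed path at the terminal time *)

Section ThetaLaw.
Context {d : measure_display} {Omega : measurableType d} {R : realType}.
Variables (P : probability Omega R) (W : R -> Omega -> R) (mu x y T : R).
Hypotheses (bmW : standard_brownian_motion P W) (T0 : 0 < T).

Let Z (w : Omega) : R :=
  Theta_tilde mu y T (fun t => x - mu * (T - t) + W (T - t) w) T.

Let a : R := y - x + mu * T.

Let Y (w : Omega) : R := W T w - W 0 w.

Let mW t : 0 <= t -> measurable_fun setT (W t).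
Proof. exact: (bm_measurable bmW). Qed.

Let mW0 : measurable_fun setT (W 0). Proof. exact: mW. Qed.

Let mWT : measurable_fun setT (W T). Proof. by apply: mW; exact: ltW. Qed.

Let mY : measurable_fun setT Y. Proof. exact: measurable_funB. Qed.

(** Along the reversed path, [omega_path] at time [v] is [W (T - v) - W T], so
    the infimum in [L_path] is governed by the running maximum of [W].  It is at
    least [z + Y w] if and only if [Y w] is at most [- z] and [W] never exceeds
    the stated level. *)
Lemma Theta_tilde_ge (z : R) (w : Omega) :
  z <= Z w <->
  (a < W T w /\ z <= Y w) \/
  [/\ W T w <= a, Y w <= - z & ~ exceeds W T ((a - z - W 0 w) / 2) w].
Proof.
have TT : T \in (`[0, T]%classic : set R) by rewrite inE/= in_itv/= lexx ltW.
rewrite /Z /Theta_tilde patchT// subr0.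
have -> : (y < x - mu * T + W T w) = (a < W T w).
  by rewrite /a; apply/idP/idP; lra.
rewrite /L_path /omega_path; case: (ltP a (W T w)) => aW; rewrite subrr subr0.
  by split=> [h|[[_ +]|[]]]; [left; split => //|..]; rewrite /Y; lra.
set A := (X in inf X).
have A0 : A !=set0.
  by eexists; exists 0 => /=; [rewrite in_itv/= lexx ltW|reflexivity].
have cW : {within `[0, T], continuous (fun t => W t w)}.
  apply: (continuous_subspaceW _ (@bm_continuous _ _ _ _ _ bmW w)).
  by move=> s /=; rewrite !in_itv/= andbT => /andP[].
(* The maximum of the path bounds the set below, so that its [inf] is meaningful. *)
have [c cT Wc] := EVT_max (ltW T0) cW.
have lbA : has_lbound A.
  exists (Num.min (a + W T w - 2 * W c w) 0) => _ [v /= vT <-].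
  rewrite le_min !ge_min lexx orbT andbT.
  have : W (T - v) w <= W c w by apply: Wc; move: vT; rewrite !in_itv/=; lra.
  by move=> h; apply/orP; left; rewrite /a; lra.
have key : (z + Y w <= inf A) <->
    (Y w <= - z /\ ~ exceeds W T ((a - z - W 0 w) / 2) w).
  split => [h|[h1 h2]].
    have hv v : 0 <= v <= T ->
        z + Y w <= Num.min (a + W T w - 2 * W (T - v) w) 0.
      move=> vT; apply: (le_trans h); apply: ge_inf => //.
      exists v => /=; first by rewrite in_itv.
      by congr Num.min; rewrite /a; lra.
    split.
      have := hv 0; rewrite lexx ltW// => /(_ isT).
      by rewrite le_min => /andP[_]; lra.
    move=> [s sT]; have := hv (T - s); rewrite le_min subKr.
    by move=> /(_ ltac:(lra)) /andP[]; rewrite /Y; lra.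
  apply: lb_le_inf => // _ [v /= vT <-].
  rewrite le_min; apply/andP; split; last by lra.
  rewrite leNgt; apply/negP => lt; apply: h2; exists (T - v).
    by move: vT; rewrite in_itv/=; lra.
  by move: lt; rewrite /a /Y; lra.
split=> [h|[[? _]|[_ h1 h2]]].
- right; have /key[] : z + Y w <= inf A by rewrite /Y; lra.
  by move=> h1 h2; split.
- by lra.
- have /key : Y w <= - z /\ ~ exceeds W T ((a - z - W 0 w) / 2) w by [].
  by rewrite /Y; lra.
Qed.

Lemma measurable_Theta_tilde : measurable_fun setT Z.
Proof.
move=> mT; apply: (measurability _ (RGenCInfty.measurableE R)) => //.
move=> _ [_ [z ->] <-]; rewrite setTI.
rewrite (_ : Z @^-1` _ = ([set w | a < W T w] `&` [set w | z <= Y w]) `|`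
   ([set w | W T w <= a] `&` [set w | Y w <= - z] `&`
    ~` [set w | exceeds W T ((a - z - W 0 w) / 2) w])).
  apply: measurableU.
    by apply: measurableI; [exact: measurable_lt_fun|exact: measurable_le_fun].
  apply: measurableI.
    by apply: measurableI; exact: measurable_le_fun.
  apply: measurableC.
  apply: (measurable_exceeds bmW T0 (b := fun w => (a - z - W 0 w) / 2)).
  by apply: measurable_funM => //; apply: measurable_funB.
apply/seteqP; split => w /=; rewrite in_itv/= andbT.
  by move/Theta_tilde_ge => [[]|[]]; [left|right].
by move=> h; apply/Theta_tilde_ge; case: h => [[]|[[]]]; [left|right].
Qed.

Let p (A : set Omega) : R := fine (P A).

Let pE A : measurable A -> P A = (p A)%:E.
Proof. by move=> mA; rewrite /p fineK// fin_num_measure. Qed.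

Let pU A B C : measurable A -> measurable B -> A `|` B = C -> A `&` B = set0 ->
  p C = p A + p B.
Proof.
move=> mA mB <- AB0; by rewrite /p measureU// fineD// fin_num_measure.
Qed.

Lemma start_ae (A B : set Omega) : measurable A -> measurable B ->
  (forall w, W 0 w = 0 -> (A w <-> B w)) -> P A = P B.
Proof.
move=> mA mB AB; pose K := [set w | W 0 w = 0].
have mK : measurable K.
  rewrite (_ : K = W 0 @^-1` [set 0]) //.
  by rewrite -[X in measurable X]setTI; exact: mW0.
have K0 : P (~` K) = 0%E.
  by apply/negligibleP; [exact: measurableC|exact: (bm_start bmW)].
have E C : measurable C -> P C = P (C `&` K).
  move=> mC; rewrite [LHS](measureDI P mC mK).
  rewrite [X in (X + _)%E](_ : _ = 0%E) ?add0e//.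
  apply: (@subset_measure0 _ _ _ P (C `\` K) (~` K)) => //.
    exact: measurableD.
  exact: measurableC.
rewrite (E A)// (E B)//; congr (P _); apply/seteqP.
by split => w [Cw Kw]; split => //; apply/(AB w Kw).
Qed.

(** If [z] is above [a], the level [b] is negative and the second alternative of
    [Theta_tilde_ge] is void.  Otherwise the reflection principle with
    [c = min(a, - z)] computes the probability of this alternative; here
    [2 * b - c] is [max(a, - z)], since [b] is the midpoint of [a] and [- z].
    Whichever of [a] and [- z] is the smaller, the sum with the probability of
    [a < Y] is the probability of [Y <= - z], and [Y] is symmetric. *)
Lemma prob_Theta_tilde_ge (z : R) :
  P [set w | z <= Z w] = P [set w | z <= W T w].
Proof.
have mle (f : Omega -> R) (r : R) : measurable_fun setT f ->
    measurable [set w | f w <= r].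
  by move=> mf; exact: measurable_le_fun.
have mlt (f : Omega -> R) (r : R) : measurable_fun setT f ->
    measurable [set w | r < f w].
  by move=> mf; exact: measurable_lt_fun.
have mge (f : Omega -> R) (r : R) : measurable_fun setT f ->
    measurable [set w | r <= f w].
  by move=> mf; exact: measurable_le_fun.
have mZ := measurable_Theta_tilde.
rewrite (@start_ae [set w | z <= W T w] [set w | z <= Y w]); first last.
- by move=> w W0; rewrite /Y /= W0 subr0.
- exact: mge.
- exact: mge.
pose b := (a - z) / 2; pose c := Num.min a (- z).
have mex : measurable (exceeds W T b).
  exact: (measurable_exceeds bmW T0 (b := cst b)).
pose E1 := [set w | a < Y w] `&` [set w | z <= Y w].
pose E2 := [set w | Y w <= c] `&` ~` exceeds W T b.
have mE1 : measurable E1 by apply: measurableI; [exact: mlt|exact: mge].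
have mE2 : measurable E2.
  by apply: measurableI; [exact: mle|exact: measurableC].
rewrite (@start_ae [set w | z <= Z w] (E1 `|` E2)); first last.
- move=> w W0; apply: (iff_trans (Theta_tilde_ge z w)).
  rewrite /E1 /E2 /Y /= W0 !subr0 -/b /c le_min.
  by split=> [[]|[[]|[/andP[]]]]; [left|case=> -> -> ?;right|left|right].
- exact: measurableU.
- exact: mge.
have [za|az] := leP z a; last first.
  congr (P _); apply/seteqP; split => w /=.
    move=> [[]//|[_]]; case; exists 0; first by rewrite lexx ltW.
    by rewrite subrr /b; lra.
  by move=> zY; left; split => //=; lra.
have symY : p [set w | Y w <= - z] = p [set w | z <= Y w].
  rewrite /p (_ : [set w | Y w <= - z] = Y @^-1` `]-oo, - z]); last first.
    by apply/seteqP; split => w /=; rewrite in_itv.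
  rewrite (increment_sym bmW) ?lexx ?ltW//.
  by congr (fine (P _)); apply/seteqP; split => w /=; rewrite in_itv/= lerN2.
have pE12 : p (E1 `|` E2) = p [set w | a < Y w] + p E2.
  rewrite (pU mE1 mE2)//; last first.
    apply/seteqP; split => // w [[/= aY _] [/= + _]].
    by rewrite /c le_min => /andP[]; lra.
  congr (p _ + _); apply/seteqP; split => w /= => [[]//|aY].
  by split => //=; lra.
have compl r : p [set w | r < Y w] + p [set w | Y w <= r] = p setT.
  apply/esym/pU; [exact: mlt|exact: mle|..].
    apply/seteqP; split => // w _ /=.
    by case: (ltP r (Y w)); [left|right].
  by apply/seteqP; split => // w [/=]; lra.
have b0 : 0 <= b by rewrite /b; lra.
have cb : c <= b by rewrite /c /b; case: (leP a (- z)); lra.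
have reflected : p [set w | Y w <= c] = p E2 + p [set w | 2 * b - c < Y w].
  rewrite /p -(reflection_principle bmW T0 b0 cb) -/(p _) -/(p _).
  have mc : measurable [set w | Y w <= c] by exact: mle.
  apply: pU => //; first exact: measurableI.
    apply/seteqP; split => w /= => [[[]//|[]//]|Yc].
    by case: (pselect (exceeds W T b w)) => ?; [right|left].
  by apply/seteqP; split => // w [[_ h] [/h]].
rewrite pE ?pE; [|exact: mge|exact: measurableU].
congr EFin; rewrite pE12 -symY.
have [az|az] := leP a (- z).
- have cE : c = a by apply/min_idPl.
  rewrite cE (_ : 2 * b - a = - z) in reflected; last by rewrite /b; lra.
  by have := compl a; have := compl (- z); lra.
- have cE : c = - z by apply/min_idPr/ltW.
  rewrite cE (_ : 2 * b - - z = a) in reflected; last by rewrite /b; lra.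
  by lra.
Qed.

End ThetaLaw.

Unset Implicit Arguments.

Theorem proposition1p2 (R : realType) (d : measure_display)
    (Omega : measurableType d) (P : probability Omega R)
    (W : R -> Omega -> R) (mu x y T : R) :
  0 < T ->
  standard_brownian_motion P W ->
  let Xhat (w : Omega) (s : R) := x - mu * s + W s w in
  same_distribution P
    (fun w => Theta_tilde mu y T (fun t => Xhat w (T - t)) T)
    (W T).
Proof.
move=> T0 bmW Xhat; apply: same_distribution_ge.
- exact: (measurable_Theta_tilde mu x y bmW T0).
- by apply: (bm_measurable bmW); exact: ltW.
- exact: (prob_Theta_tilde_ge mu x y bmW T0).
Qed.
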